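(* Let $V$ be a finite-dimensional diffeological vector space. The maximal isotropic subspace is an invariant with respect to the choice of a pseudo-metric on $V$; that is, any two pseudo-metrics on $V$ have the same maximal isotropic subspace.
   Context: A diffeological space is a set $X$ with a collection of maps (plots) $U\to X$, for $U$ open in $\mathbb{R}^n$, $n\in\mathbb{N}$, such that: constant maps are plots; the composition of a plot with an ordinary smooth map between open sets of Euclidean spaces is a plot; a map that is locally a plot is a plot. A map $f:X\to Y$ is smooth if $f\circ p$ is a plot of $Y$ for every plot $p$ of $X$. A diffeological vector space is a real vector space with a diffeology for which addition and scalar multiplication are smooth (products carry the product diffeology, $\mathbb{R}$ its standard diffeology). The diffeological dual $V^*$ is the vector space of all smooth linear maps $V\to\mathbb{R}$. A diffeological pseudo-metric on a diffeological vector space $V$ of finite dimension $n$ is a smooth symmetric semi-positive definite bilinear form $g:V\times V\to\mathbb{R}$ whose maximal isotropic subspace (the subspace $\{v\in V: g(v,w)=0\ \forall w\in V\}$) has dimension exactly $n-\dim(V^* )$. *)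

(* Defs.v *)
From HB Require Import structures.
From mathcomp Require Import all_boot all_order all_algebra sesquilinear.
From mathcomp Require Import all_classical all_reals all_analysis.

Set Implicit Arguments.
Unset Strict Implicit.
Unset Printing Implicit Defensive.

Import Order.TTheory GRing.Theory Num.Theory.
Import numFieldNormedType.Exports.

Local Open Scope classical_set_scope.
Local Open Scope ring_scope.

Section Smooth.
Context {R : realType}.

(* Functions on an open subset [U] of R^n are total functions whose values
   outside [U] are irrelevant; see [Ck_eq]. In finite dimension, [f] is C^(k+1)
   iff it is differentiable and [x |-> 'd f x v] is C^k for every [v]. *)
Fixpoint Ck (k n : nat) (W : normedModType R) (U : set 'rV[R]_n)
    (f : 'rV[R]_n -> W) : Prop :=
  match k with
  | 0 => forall x, U x -> {for x, continuous f}
  | k'.+1 => (forall x, U x -> differentiable f x) /\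
             (forall v, Ck k' U (fun x => 'd f x v))
  end.

Definition smooth_on (n : nat) (W : normedModType R) (U : set 'rV[R]_n)
  (f : 'rV[R]_n -> W) : Prop := forall k, Ck k U f.

Section CkTheory.
Context {n : nat} {W : normedModType R}.
Implicit Types (U : set 'rV[R]_n) (f g : 'rV[R]_n -> W).

Lemma differentiable_near (f g : 'rV[R]_n -> W) x :
  (\forall y \near x, f y = g y) -> differentiable f x ->
  differentiable g x /\ 'd g x = 'd f x :> (_ -> _).
Proof.
move=> fg df.
have fgx : f x = g x by exact: nbhs_singleton fg.
have [dc /eqaddoP Ho] := (diff_locallyP x f).1 df.
have cc : g \o shift x = cst (g x) + 'd f x +o_ 0 id.
  apply/eqaddoP => e e0; move: (Ho e e0).
  have fg0 : \forall h \near (0 : 'rV[R]_n), f (h + x) = g (h + x).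
    by move: fg; rewrite (near_shift 0 x)/= subr0; apply: filterS => h.
  move=> H; near=> h.
  have H1 : f (h + x) = g (h + x) by near: h.
  have : `|(f \o shift x - (cst (f x) + 'd f x)) h| <= e * `|h| by near: h.
  by rewrite !fctE /= H1 fgx.
have dE : 'd g x = 'd f x :> (_ -> _) by exact: diff_unique.
by split=> //; apply/diff_locallyP; rewrite dE.
Unshelve. all: by end_near. Qed.


Lemma Ck_eq k U f g :
  open U -> (forall x, U x -> f x = g x) -> Ck k U f -> Ck k U g.
Proof.
move=> oU; have nfg f' g' x : (forall x, U x -> f' x = g' x :> W) -> U x ->
    \forall y \near x, f' y = g' y.
  by move=> fg Ux; move: (open_nbhs_nbhs (conj oU Ux)); apply: filterS.
elim: k f g => [|k IH] f g fg /=.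
  move=> cf x Ux; have fgx := nfg _ _ _ fg Ux.
  have := cf x Ux; rewrite /prop_for /continuous_at (fg x Ux).
  move=> cfx; apply: cvg_trans cfx.
  exact: (@near_eq_cvg _ _ (nbhs x)).
move=> [df Cf]; split=> [x Ux|v].
  by have [] := differentiable_near (nfg _ _ _ fg Ux) (df x Ux).
apply: IH (Cf v) => x Ux.
by have [_ ->] := differentiable_near (nfg _ _ _ fg Ux) (df x Ux).
Qed.

Lemma Ck_pred k U f : Ck k.+1 U f -> Ck k U f.
Proof.
elim: k f => [|k IH] f [df Cf].
  by move=> x Ux; exact/differentiable_continuous/df.
by split=> // v; exact: IH.
Qed.

Lemma Ck_subset k U (U' : set 'rV[R]_n) f : U' `<=` U -> Ck k U f -> Ck k U' f.
Proof.
move=> sU; elim: k f => [|k IH] f /=.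
  by move=> cf x /sU; exact: cf.
by move=> [df Cf]; split=> [x /sU|v]; [exact: df|exact: IH].
Qed.

Lemma Ck_local k U f :
  (forall x, U x -> exists2 U', U' x & Ck k U' f) -> Ck k U f.
Proof.
elim: k f => [|k IH] f /= loc.
  by move=> x Ux; have [U' U'x] := loc x Ux; exact.
split=> [x Ux|v].
  by have [U' U'x [+ _]] := loc x Ux; exact.
by apply: IH => x Ux; have [U' U'x [_ Cf]] := loc x Ux; exists U'.
Qed.

Lemma Ck_cst k U (a : W) : Ck k U (fun=> a).
Proof.
elim: k a => [|k IH] a /=; first by move=> x _; exact: cst_continuous.
split=> [x _|v]; first exact: differentiable_cst.
rewrite (_ : (fun _ => _) = fun=> 0)//.
by apply/funext => x; rewrite diff_cst.
Qed.

Lemma CkD k U f g : open U -> Ck k U f -> Ck k U g ->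
  Ck k U (fun x => f x + g x).
Proof.
move=> oU; elim: k f g => [|k IH] f g /=.
  by move=> cf cg x Ux; exact: (continuousD (cf x Ux) (cg x Ux)).
move=> [df Cf] [dg Cg]; split=> [x Ux|v].
  by apply: differentiableD; [exact: df|exact: dg].
apply: (Ck_eq oU _ (IH _ _ (Cf v) (Cg v))) => x Ux.
by rewrite (diffD (df x Ux) (dg x Ux)).
Qed.

Lemma Ck_sum k U m (f : 'I_m -> 'rV[R]_n -> W) : open U ->
  (forall i, Ck k U (f i)) -> Ck k U (fun x => \sum_i f i x).
Proof.
move=> oU; elim: m f => [|m IH] f Cf.
  rewrite (_ : (fun _ => _) = fun=> 0); first exact: Ck_cst.
  by apply/funext => x; rewrite big_ord0.
rewrite (_ : (fun _ => _) =
    fun x => f ord0 x + \sum_i f (lift ord0 i) x); last first.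
  by apply/funext => x; rewrite big_ord_recl.
by apply: CkD => //; exact: IH.
Qed.

End CkTheory.

Lemma CkM n k (U : set 'rV[R]_n) (f g : 'rV[R]_n -> R) : open U ->
  Ck k U f -> Ck k U g -> Ck k U (fun x => f x * g x).
Proof.
move=> oU; elim: k f g => [|k IH] f g.
  by move=> cf cg x Ux; exact: (continuousM (cf x Ux) (cg x Ux)).
move=> Cf1 Cg1; have [df Cf] := Cf1; have [dg Cg] := Cg1.
split=> [x Ux|v].
  by apply: differentiableM; [exact: df|exact: dg].
apply: (Ck_eq oU _ (CkD oU (IH _ _ (Ck_pred Cf1) (Cg v))
                           (IH _ _ (Ck_pred Cg1) (Cf v)))) => x Ux.
have /differentiableP dfx := df x Ux; have /differentiableP dgx := dg x Ux.
by have /@diff_val/(congr1 (@^~ v)) /= := is_diffM dfx dgx.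
Qed.

Lemma Ck_coord n m k (U : set 'rV[R]_n) (F : 'rV[R]_n -> 'rV[R]_m) j :
  open U -> Ck k U F -> Ck k U (fun x => F x ord0 j : R).
Proof.
pose cj : 'rV[R]_m -> R := fun y => y ord0 j.
have cjl : linear cj by move=> a y z; rewrite /cj !mxE.
pose cjL : {linear 'rV[R]_m -> R} :=
  HB.pack cj (GRing.isLinear.Build _ _ _ _ _ cjl).
have cjc : continuous cjL by exact: coord_continuous.
move=> oU; elim: k F => [|k IH] F.
  move=> cF x Ux; apply: (@continuous_comp _ _ _ F cj); first exact: cF.
  exact: cjc.
move=> [dF CF]; split=> [x Ux|v].
  apply: (@differentiable_comp _ _ _ _ F cj); first exact: dF.
  exact: differentiable_coord.
apply: (Ck_eq oU _ (IH _ (CF v))) => x Ux.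
rewrite (@diff_comp _ _ _ _ F cj)//=; [|exact: dF|exact: differentiable_coord].
by rewrite (@diff_lin _ _ _ cjL).
Qed.

Lemma Ck_comp n m k (U : set 'rV[R]_n) (U' : set 'rV[R]_m)
    (f : 'rV[R]_n -> R) (F : 'rV[R]_m -> 'rV[R]_n) :
  open U' -> F @` U' `<=` U -> Ck k U f -> Ck k U' F -> Ck k U' (f \o F).
Proof.
move=> oU' sU; have sFU x : U' x -> U (F x) by move=> U'x; apply: sU; exists x.
elim: k f F sU sFU => [|k IH] f F sU sFU.
  move=> cf cF x Ux; apply: continuous_comp; first exact: cF.
  exact/cf/sFU.
move=> [df Cf] CF1; have [dF CF] := CF1; split=> [x Ux|v].
  by apply: differentiable_comp; [exact: dF|exact/df/sFU].
pose h x := \sum_j 'd F x v ord0 j * 'd f (F x) (delta_mx ord0 j).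
apply: (@Ck_eq _ _ _ _ h) => //.
  move=> x Ux; rewrite diff_comp//=; [|exact: dF|exact/df/sFU].
  rewrite (row_sum_delta ('d F x v)) linear_sum.
  by apply: eq_bigr => j _; rewrite linearZ.
apply: Ck_sum => // j; apply: CkM => //.
  exact: (Ck_coord j oU' (CF v)).
exact: (IH _ _ sU sFU (Cf (delta_mx ord0 j)) (Ck_pred CF1)).
Qed.

End Smooth.

(* As in [Ck], a plot [U -> X] is the restriction to [U] of a total function
   (axiom [plot_eq]). *)
HB.mixin Record isDiffeological (R : realType) (X : Type) := {
  plot : forall n, set 'rV[R]_n -> ('rV[R]_n -> X) -> Prop;
  plot_open : forall n (U : set 'rV[R]_n) p, plot n U p -> open U;
  plot_eq : forall n (U : set 'rV[R]_n) p q,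
    (forall x, U x -> p x = q x) -> plot n U p -> plot n U q;
  plot_cst : forall n (U : set 'rV[R]_n) a, open U -> plot n U (fun=> a);
  plot_comp : forall n m (U : set 'rV[R]_n) (U' : set 'rV[R]_m)
      (p : 'rV[R]_n -> X) (F : 'rV[R]_m -> 'rV[R]_n),
    plot n U p -> open U' -> F @` U' `<=` U -> smooth_on U' F ->
    plot m U' (p \o F);
  plot_local : forall n (U : set 'rV[R]_n) p, open U ->
    (forall x, U x -> exists U', [/\ U' x, U' `<=` U & plot n U' p]) ->
    plot n U p }.

#[short(type="diffeologicalType")]
HB.structure Definition Diffeological (R : realType) :=
  {X of isDiffeological R X}.

Definition smooth (R : realType) (X Y : diffeologicalType R) (f : X -> Y) :=
  forall n (U : set 'rV[R]_n) (p : 'rV[R]_n -> X),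
    plot n U p -> plot n U (f \o p).

Section StandardDiffeology.
Context {R : realType}.

Definition std_plot n (U : set 'rV[R]_n) (p : 'rV[R]_n -> R^o) :=
  open U /\ smooth_on U p.

Let std_open n (U : set 'rV[R]_n) p : std_plot U p -> open U.
Proof. by case. Qed.

Let std_eq n (U : set 'rV[R]_n) p q :
  (forall x, U x -> p x = q x) -> std_plot U p -> std_plot U q.
Proof. by move=> pq [oU Cp]; split=> // k; exact: Ck_eq (Cp k). Qed.

Let std_cst n (U : set 'rV[R]_n) a : open U -> std_plot U (fun=> a).
Proof. by move=> oU; split=> // k; exact: Ck_cst. Qed.

Let std_comp n m (U : set 'rV[R]_n) (U' : set 'rV[R]_m) p F :
  std_plot U p -> open U' -> F @` U' `<=` U -> smooth_on U' F ->
  std_plot U' (p \o F).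
Proof.
by move=> [oU Cp] oU' sU CF; split=> // k; exact: Ck_comp (Cp k) (CF k).
Qed.

Let std_local n (U : set 'rV[R]_n) p : open U ->
  (forall x, U x -> exists U', [/\ U' x, U' `<=` U & std_plot U' p]) ->
  std_plot U p.
Proof.
move=> oU loc; split=> // k; apply: Ck_local => x /loc[U' [U'x _ [_ Cp]]].
by exists U'.
Qed.

HB.instance Definition _ := isDiffeological.Build R R^o
  std_open std_eq std_cst std_comp std_local.

End StandardDiffeology.

Section ProductDiffeology.
Context {R : realType} (X Y : diffeologicalType R).

Definition prod_plot n (U : set 'rV[R]_n) (p : 'rV[R]_n -> X * Y) :=
  plot n U (fst \o p) /\ plot n U (snd \o p).

Let prod_open n (U : set 'rV[R]_n) p : prod_plot U p -> open U.
Proof. by case=> /plot_open. Qed.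

Let prod_eq n (U : set 'rV[R]_n) p q :
  (forall x, U x -> p x = q x) -> prod_plot U p -> prod_plot U q.
Proof.
move=> pq [p1 p2].
by split; [apply: plot_eq p1|apply: plot_eq p2] => x Ux /=; rewrite pq.
Qed.

Let prod_cst n (U : set 'rV[R]_n) a : open U -> prod_plot U (fun=> a).
Proof. by move=> oU; split; exact: plot_cst. Qed.

Let prod_comp n m (U : set 'rV[R]_n) (U' : set 'rV[R]_m) p F :
  prod_plot U p -> open U' -> F @` U' `<=` U -> smooth_on U' F ->
  prod_plot U' (p \o F).
Proof.
move=> [p1 p2] oU' sU CF.
by split; [exact: plot_comp p1 _ _ _|exact: plot_comp p2 _ _ _].
Qed.

Let prod_local n (U : set 'rV[R]_n) p : open U ->
  (forall x, U x -> exists U', [/\ U' x, U' `<=` U & prod_plot U' p]) ->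
  prod_plot U p.
Proof.
by move=> oU loc; split; apply: plot_local => // x /loc[U' [U'x sU [p1 p2]]];
   exists U'.
Qed.

HB.instance Definition _ := isDiffeological.Build R (X * Y)%type
  prod_open prod_eq prod_cst prod_comp prod_local.

End ProductDiffeology.

HB.mixin Record Diffeological_isDiffVect (R : realType) V
    of GRing.Lmodule R V & Diffeological R V := {
  smooth_add : smooth (fun x : V * V => x.1 + x.2);
  smooth_scale : smooth (fun x : R^o * V => (x.1 : R) *: x.2) }.

#[short(type="diffVectType")]
HB.structure Definition DiffVect (R : realType) :=
  {V of GRing.Lmodule R V & Diffeological R V & Diffeological_isDiffVect R V}.

#[short(type="finDiffVectType")]
HB.structure Definition FinDiffVect (R : realType) :=
  {V of Vector R V & DiffVect R V}.

Lemma exists_subspace (R : realType) (W : vectType R) (A : set W) :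
  A 0 -> (forall a u v, A u -> A v -> A (a *: u + v)) ->
  exists S : {vspace W}, forall v, (v \in S) <-> A v.
Proof.
move=> A0 AP.
pose P d := `[<
  exists2 S : {vspace W}, \dim S = d & forall v, v \in S -> A v >].
have exP : exists d, P d.
  exists 0%N; apply/asboolP; exists 0%VS; first by rewrite dimv0.
  by move=> v; rewrite memv0 => /eqP ->.
have leP d : P d -> (d <= \dim {:W})%N.
  by move=> /asboolP[S <- _]; exact/dimvS/subvf.
case: (ex_maxnP exP leP) => d /asboolP[S dS SA] maxd.
exists S => v; split; first exact: SA.
move=> Av; apply: contrapT => /negP vS.
have : (\dim (<[v]> + S) <= d)%N.
  apply/maxd/asboolP; exists (<[v]> + S)%VS => // w.
  by move=> /memv_addP[_ /vlineP[a ->] [u uS ->]]; apply: AP => //; exact: SA.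
have sS : (S <= <[v]> + S)%VS by exact: addvSr.
rewrite -dS => dle; have /eqP E : S == (<[v]> + S)%VS by rewrite eqEdim sS.
move/negP: vS; apply; rewrite E.
by apply: (subvP (addvSl _ _)); exact: memv_line.
Qed.

Section PseudoMetric.
Context {R : realType} (V : finDiffVectType R).

Lemma dual_exists : exists S : {vspace 'Hom(V, R^o)},
  forall f, (f \in S) <-> smooth f.
Proof.
apply: exists_subspace => [|a f g sf sg] n U p Up.
  have := @plot_cst R R^o n U 0 (plot_open _ _ _ Up).
  apply: plot_eq => x _ /=.
  by rewrite lfunE.
have [oU Cf] := sf n U p Up; have [_ Cg] := sg n U p Up.
split=> // k.
apply: (Ck_eq oU _ (CkD oU (CkM oU (Ck_cst k U a) (Cf k)) (Cg k))).
by move=> x _ /=; rewrite lfunE/= lfunE.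
Qed.

(* the diffeological dual V^*, as a subspace of the algebraic dual *)
Definition ddual : {vspace 'Hom(V, R^o)} := sval (cid dual_exists).

Lemma ddualP (f : 'Hom(V, R^o)) : (f \in ddual) <-> smooth f.
Proof. exact: (svalP (cid dual_exists)). Qed.

Lemma isotropic_exists (g : {biscalar V}) : exists S : {vspace V},
  forall v, (v \in S) <-> (forall w, g v w = 0).
Proof.
apply: exists_subspace => [w|a u v gu gv w]; first by rewrite linear0l.
by rewrite linearPl gu gv mulr0 addr0.
Qed.

Definition isotropic (g : {biscalar V}) : {vspace V} :=
  sval (cid (isotropic_exists g)).

Lemma isotropicP (g : {biscalar V}) v :
  (v \in isotropic g) <-> (forall w, g v w = 0).
Proof. exact: (svalP (cid (isotropic_exists g))). Qed.

(* [\dim ddual <= \dim {:V}], so the subtraction is not truncated *)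
Record pseudo_metric (g : {biscalar V}) : Prop := PseudoMetric {
  pm_smooth : smooth (fun x : V * V => g x.1 x.2 : R^o);
  pm_sym : forall v w, g v w = g w v;
  pm_ge0 : forall v, 0 <= g v v;
  pm_dim : \dim (isotropic g) = (\dim {:V} - \dim ddual)%N }.

End PseudoMetric.

(* Main.v *)
(* The map [v |-> g v] sends [V] into its diffeological dual, with kernel the
   isotropic subspace of [g]; the dimension condition makes it onto the dual.
   By symmetry the isotropic subspace is then the common kernel of all smooth
   linear forms, which does not depend on [g]. *)
From HB Require Import structures.
Require Import Defs.
From mathcomp Require Import all_boot all_order all_algebra sesquilinear.
From mathcomp Require Import all_classical all_reals all_analysis.

Set Implicit Arguments.
Unset Strict Implicit.

Local Open Scope ring_scope.

Import GRing.Theory.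

Section PolarMap.
Context {R : realType} {V : finDiffVectType R} (g : {biscalar V}).

Definition polar (v : V) : 'Hom(V, R^o) := linfun (g v : V -> R^o).

Lemma polarE v w : polar v w = g v w.
Proof. by rewrite lfunE. Qed.

Lemma polar_is_linear : linear polar.
Proof.
by move=> a u v; apply/lfunP => w; rewrite add_lfunE scale_lfunE !polarE linearPl.
Qed.

HB.instance Definition _ :=
  GRing.isLinear.Build R V 'Hom(V, R^o) _ polar polar_is_linear.

Lemma lker_polar : lker (linfun polar) = isotropic g.
Proof.
apply/vspaceP => v; rewrite memv_ker lfunE /=; apply/eqP/idP.
  by move=> gv0; apply/isotropicP => w; rewrite -polarE gv0 lfunE.
by move=> /isotropicP gv0; apply/lfunP => w; rewrite polarE gv0 lfunE.
Qed.

Hypothesis hg : pseudo_metric g.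

(** Pairing a plot [p] with the constant plot at [v] gives a plot of [V * V], on which [g] is
    smooth. *)
Lemma polar_ddual v : polar v \in ddual V.
Proof.
apply/ddualP => n U p Up.
have Uvp : plot n U (fun x => (v, p x)).
  by split=> //; exact: plot_cst (plot_open _ _ _ Up).
by apply: plot_eq (pm_smooth hg Uvp) => x _ /=; rewrite polarE.
Qed.

Lemma dim_ddual : (\dim (ddual V) <= \dim {:V})%N.
Proof.
(* The algebraic dual has dimension [\dim {:V} * 1]. *)
by apply: leq_trans (dimvS (subvf _)) _; rewrite !dimvf /dim /= muln1.
Qed.

Lemma limg_polar : limg (linfun polar) = ddual V.
Proof.
apply/eqP; rewrite eqEdim; apply/andP; split.
  by apply/subvP => _ /memv_imgP[v _ ->]; rewrite lfunE polar_ddual.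
have := limg_ker_dim (linfun polar) fullv.
rewrite capfv lker_polar (pm_dim hg) => dimE.
(* Rank-nullity: the rank is [\dim {:V}] minus the dimension of the kernel; [dim_ddual] lets [subnK]
   undo the natural-number subtraction. *)
by rewrite -(leq_add2l (\dim {:V} - \dim (ddual V))) dimE subnK ?dim_ddual.
Qed.

Lemma isotropic_ddual v :
  v \in isotropic g <-> (forall f, f \in ddual V -> f v = 0).
Proof.
split=> [/isotropicP gv0 f|fv0].
  (* Surjectivity onto the dual: every smooth form [f] is [polar w] for some [w]. *)
  rewrite -limg_polar => /memv_imgP[w _ ->].
  by rewrite lfunE polarE (pm_sym hg) gv0.
apply/isotropicP => w.
by rewrite (pm_sym hg) -polarE fv0 ?polar_ddual.
Qed.

End PolarMap.

Theorem lemma2p10 (R : realType) (V : finDiffVectType R) (g h : {biscalar V})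
    (hg : pseudo_metric g) (hh : pseudo_metric h) :
  isotropic g = isotropic h.
Proof.
apply/vspaceP => v; apply/idP/idP.
  by move/(isotropic_ddual hg)/(isotropic_ddual hh).
by move/(isotropic_ddual hh)/(isotropic_ddual hg).
Qed.
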